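(* Let $G$ be a graph with maximal degree $\Delta_G$ and first (smallest non-zero) normalized Laplace eigenvalue $\tilde{\lambda}_G$. The stable gonality of $G$ is bounded from below by $$\mathrm{sgon}(G)\geq \frac{\tilde \lambda_G}{\Delta_G\tilde\lambda_G+4(\Delta_G+1)}\,\mathrm{vol}(G).$$
   Context: Graphs are finite and connected; multiple edges and loops are allowed. For a graph $G$, $V(G)$ and $E(G)$ are its sets of vertices and edges, $|G|=|V(G)|$, $E(x,y)$ is the set of edges joining $x$ and $y$, and $E_v(G)$ is the set of edges incident to $v$. The degree $d_v$ of a vertex is the number of edges incident to it, loops counted twice; $\Delta_G=\max_v d_v$ and $\mathrm{vol}(G)=\sum_{v\in V(G)}d_v=2|E(G)|$. A tree is a connected graph with $|E|-|V|+1=0$. A graph $G'$ is a refinement of $G$ if it is obtained from $G$ by performing finitely many times one of the operations: (1) subdivision of an edge; (2) addition of a leaf, i.e. of an extra vertex and an edge between this vertex and an already existing vertex. The Laplacian is $L_G=D_G-A_G$, with $D_G$ the diagonal matrix of vertex degrees and $A_G$ the adjacency matrix, whose $(x,y)$-entry is $|E(x,y)|$ (loops counted twice on the diagonal, as in the degree, so that constant functions are in the kernel of $L_G$). The normalized Laplacian is $L_G^\sim=D_G^{-1/2}L_GD_G^{-1/2}$, and $\tilde\lambda_G$ is its smallest non-zero eigenvalue (defined when $|G|\geq2$). Let $G,G'$ be loopless graphs. A finite morphism $\varphi:G\to G'$ is a map $V(G)\cup E(G)\to V(G')\cup E(G')$ with $\varphi(V(G))\subset V(G')$ and $\varphi(e)\in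 E(\varphi(x),\varphi(y))$ for every $e\in E(x,y)$, together with a positive integer $r_\varphi(e)$ (the index) for each $e\in E(G)$. It is harmonic if for every $v\in V(G)$ there is a well-defined number $m_\varphi(v)$ such that $m_\varphi(v)=\sum_{e\in E_v(G),\,\varphi(e)=e'}r_\varphi(e)$ for every $e'\in E_{\varphi(v)}(G')$ (if $E_{\varphi(v)}(G')=\emptyset$, then $m_\varphi(v)$ may be chosen to be any positive integer). The degree of a finite harmonic morphism is $\deg\varphi=\sum_{v\in\varphi^{-1}(v')}m_\varphi(v)=\sum_{e\in\varphi^{-1}(e')}r_\varphi(e)$, which is independent of $v'\in V(G')$ and $e'\in E(G')$. The stable gonality $\mathrm{sgon}(G)$ of a graph $G$ is the minimum of $\deg\varphi$ over all finite harmonic morphisms $\varphi:G'\to T$ with $G'$ a (loopless) refinement of $G$ and $T$ a tree. *)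

(* Defs.v *)
From mathcomp Require Import all_boot all_order all_algebra.
From mathcomp Require Import reals.

Set Implicit Arguments.
Unset Strict Implicit.
Unset Printing Implicit Defensive.

Import Order.TTheory GRing.Theory Num.Theory.

(* Finite graphs with multiple edges and loops. The order of the two entries
   of [ends e] is an arbitrary choice: all notions below are symmetric. *)
Record mgraph := MGraph {
  vert : finType;
  edge : finType;
  ends : edge -> vert * vert }.

Section Graph.
Variable G : mgraph.
Implicit Types (x y v : vert G) (e : edge G).

Definition edges_between x y : {set edge G} :=
  [set e | (ends e == (x, y)) || (ends e == (y, x))].

Definition incident v : {set edge G} :=
  [set e | ((ends e).1 == v) || ((ends e).2 == v)].

(* The loops at [v] lie in [incident v] and are counted a second time. *)
Definition vdeg v : nat := #|incident v| + #|edges_between v v|.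

Definition maxdeg : nat := \max_v vdeg v.

Definition vol : nat := \sum_v vdeg v.

Definition adjacent : rel (vert G) := [rel x y | edges_between x y != set0].

Definition connected : Prop := forall x y, connect adjacent x y.

Definition loopless : Prop := forall v, edges_between v v = set0.

(* The count of edges also forces [vert G] to be nonempty. *)
Definition is_tree : Prop := connected /\ #|edge G| + 1 = #|vert G|.

End Graph.

Arguments is_tree G : clear implicits.
Arguments connected G : clear implicits.
Arguments loopless G : clear implicits.
Arguments maxdeg G : clear implicits.
Arguments vol G : clear implicits.

Definition graph_iso (G H : mgraph) : Prop :=
  exists (f : vert G -> vert H) (g : edge G -> edge H),
    [/\ bijective f, bijective g &
        forall e x y, e \in edges_between x y ->
                      g e \in edges_between (f x) (f y)].

(* The new vertex is [None]; the two halves of [e = (x, y)] are the edge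
   [Some e] from [x] to [None] and the edge [None] from [None] to [y]. *)
Definition subdivide (G : mgraph) (e : edge G) : mgraph :=
  @MGraph (option (vert G)) (option (edge G))
    (fun o => match o with
     | Some e' => (Some (ends e').1,
                   if e' == e then None else Some (ends e').2)
     | None => (None, Some (ends e).2)
     end).

Definition add_leaf (G : mgraph) (v : vert G) : mgraph :=
  @MGraph (option (vert G)) (option (edge G))
    (fun o => match o with
     | Some e' => (Some (ends e').1, Some (ends e').2)
     | None => (Some v, None)
     end).

(* [refinement G G'] : [G'] is a refinement of [G]. *)
Inductive refinement (G : mgraph) : mgraph -> Prop :=
| refinement_refl : refinement G G
| refinement_subdivide H (e : edge H) :
    refinement G H -> refinement G (subdivide e)
| refinement_leaf H (v : vert H) :
    refinement G H -> refinement G (add_leaf v)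
| refinement_iso H K :
    refinement G H -> graph_iso H K -> refinement G K.

Record finite_morphism (G H : mgraph) := FiniteMorphism {
  mor_v : vert G -> vert H;
  mor_e : edge G -> edge H;
  edge_index : edge G -> nat;
  mor_ends : forall e x y, e \in edges_between x y ->
                           mor_e e \in edges_between (mor_v x) (mor_v y);
  edge_index_gt0 : forall e, 0 < edge_index e }.

(* The second clause concerns only a target vertex without edges, where the
   multiplicity is a free positive integer and hence part of the data. *)
Definition harmonic (G H : mgraph) (phi : finite_morphism G H)
    (m : vert G -> nat) : Prop :=
  forall v,
    (forall e', e' \in incident (mor_v phi v) ->
       m v = \sum_(e in incident v | mor_e phi e == e') edge_index phi e) /\
    (incident (mor_v phi v) = set0 -> 0 < m v).

Record harmonic_morphism (G H : mgraph) := HarmonicMorphism {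
  hmor :> finite_morphism G H;
  mult : vert G -> nat;
  hmorP : harmonic hmor mult }.

Section Degree.
Variables (G H : mgraph) (phi : harmonic_morphism G H).

Definition degree_at (v' : vert H) : nat :=
  \sum_(v | mor_v phi v == v') mult phi v.

(* Read off at an arbitrary vertex of the target; see [degreeE] and
   [degree_edge] for the independence of that choice. *)
Definition degree : nat :=
  if [pick v' : vert H] is Some v' then degree_at v' else 0.

Lemma degree_at_edge (x y : vert H) (e' : edge H) :
  x != y -> e' \in edges_between x y ->
  degree_at x = \sum_(e | mor_e phi e == e') edge_index phi e.
Proof.
move=> nxy e'xy; rewrite /degree_at.
have e'x : e' \in incident x.
  by move: e'xy; rewrite !inE => /orP[]/eqP->; rewrite /= eqxx ?orbT.
under eq_bigr => v /eqP vx.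
  rewrite ((hmorP phi v).1 e'); last by rewrite vx.
  over.
rewrite (exchange_big_dep (fun e => mor_e phi e == e')) /=; last first.
  by move=> v e _ /andP[].
apply: eq_bigr => e /eqP ee'.
have ie : e \in edges_between (ends e).1 (ends e).2.
  by rewrite inE -surjective_pairing eqxx.
have h := mor_ends phi ie; rewrite ee' in h.
have {h} : (mor_v phi (ends e).1 == x) && (mor_v phi (ends e).2 == y)
        || (mor_v phi (ends e).2 == x) && (mor_v phi (ends e).1 == y).
  move: h e'xy; rewrite !inE => /orP[]/eqP-> /orP[]; rewrite xpair_eqE => h;
    by move: h => /andP[-> ->]; rewrite ?orbT.
rewrite ee' eqxx => /orP[]/andP[/eqP ax /eqP ay].
  rewrite (big_pred1 (ends e).1) // => v /=; rewrite inE andbT.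
  apply/andP/eqP => [[/eqP vx /orP[/eqP //|/eqP ev]]|->].
    by move: nxy; rewrite -vx -ay ev eqxx.
  by rewrite ax !eqxx.
rewrite (big_pred1 (ends e).2) // => v /=; rewrite inE andbT.
apply/andP/eqP => [[/eqP vx /orP[/eqP ev|/eqP //]]|->].
  by move: nxy; rewrite -vx -ay ev eqxx.
by rewrite ax !eqxx orbT.
Qed.

Lemma degreeE (v' : vert H) : connected H -> degree = degree_at v'.
Proof.
move=> cH; rewrite /degree; case: pickP => [x _|/(_ v')//].
have /connectP[p] := cH x v'; elim: p x => [|y p IHp] x /=; first by move=> _ ->.
move=> /andP[/set0Pn[e exy] yp] lv; rewrite -(IHp y yp lv).
have [-> //|nxy] := eqVneq x y.
rewrite (degree_at_edge nxy exy) (@degree_at_edge y x e) 1?eq_sym //.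
by move: exy; rewrite !inE orbC.
Qed.

Lemma degree_edge (e' : edge H) : connected H -> loopless H ->
  degree = \sum_(e | mor_e phi e == e') edge_index phi e.
Proof.
move=> cH lH; rewrite (degreeE (ends e').1) //.
apply: (@degree_at_edge _ (ends e').2); last first.
  by rewrite inE -surjective_pairing eqxx.
apply/eqP => h; have := lH (ends e').1 => /setP/(_ e').
by rewrite !inE {2}h -surjective_pairing eqxx.
Qed.

End Degree.

Definition gonal_degree (G : mgraph) (d : nat) : Prop :=
  exists (G' T : mgraph) (phi : harmonic_morphism G' T),
    [/\ refinement G G', loopless G', is_tree T & degree phi = d].

(* [is_sgon G d] : [d] is the stable gonality of [G]. *)
Definition is_sgon (G : mgraph) (d : nat) : Prop :=
  gonal_degree G d /\ forall d', gonal_degree G d' -> d <= d'.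

Local Open Scope ring_scope.

Section Laplacian.
Variables (R : realType) (G : mgraph).

Let vtx (i : 'I_#|vert G|) : vert G := enum_val i.

Definition deg_mx : 'M[R]_#|vert G| :=
  diag_mx (\row_i (vdeg (vtx i))%:R).

Definition adj_mx : 'M[R]_#|vert G| :=
  \matrix_(i, j) if i == j then (2 * #|edges_between (vtx i) (vtx i)|)%:R
                 else #|edges_between (vtx i) (vtx j)|%:R.

Definition laplacian : 'M[R]_#|vert G| := deg_mx - adj_mx.

Definition deg_invsqrt_mx : 'M[R]_#|vert G| :=
  diag_mx (\row_i (Num.sqrt (vdeg (vtx i))%:R)^-1).

Definition normalized_laplacian : 'M[R]_#|vert G| :=
  deg_invsqrt_mx *m laplacian *m deg_invsqrt_mx.

End Laplacian.

Definition first_eigenvalue (R : realType) (n : nat) (L : 'M[R]_n) (lam : R)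
    : Prop :=
  [/\ eigenvalue L lam, lam != 0 &
      forall mu, eigenvalue L mu -> mu != 0 -> lam <= mu].

(* Main.v *)
Require Import Defs.
From mathcomp Require Import all_boot all_order all_algebra.
From mathcomp Require Import reals.
From mathcomp Require Import complex ring lra zify.

(** The bound compares two estimates of the edge boundaries of disjoint vertex
    sets of [G] that are pulled back from the tree.

    Let [phi : G' -> T] be a finite harmonic morphism of degree [d] from a
    refinement of [G] to a tree. Weight each vertex of [T] by the total degree
    of the vertices of [G] above it; the weights add up to [vol G]. The tree
    has a weighted centroid [t]: every component of [T - t] carries at most
    half of the weight ([tree_centroid]). Let [A k] be the set of vertices of
    [G] above the [k]-th component.

    On the one hand [A k] has at most half of the volume, so testing the
    variational characterization of the first eigenvalue [lam] on its centred
    indicator function gives [lam * volume (A k) <= 2 * #|cut (A k)|]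
    ([cut_lower_bound]). The characterization ([poincare]) is the spectral
    theorem for real symmetric matrices ([symmetric_gap]) combined with the
    Dirichlet form of the Laplacian ([laplacianE]).

    On the other hand, an edge of [G] in one of the cuts is refined to a path
    of [G'] whose image leaves a component of [T - t], hence runs through [t].
    Either an end of that edge lies above [t], or a subdivision vertex of that
    edge does. At most [d] non-isolated vertices of [G'] lie above [t]
    ([card_fibre_le_degree]), a vertex of [G] among them meets at most
    [maxdeg G] edges, and a subdivision vertex belongs to a single edge, which
    lies in at most two of the cuts. Hence the cuts have at most
    [(maxdeg G + 2) * d] edges in total, while the [A k] miss at most
    [maxdeg G * d] of the volume ([centroid_cuts]). Summing over [k],
    [lam * (vol G - maxdeg G * d) <= 2 * (maxdeg G + 2) * d], and the right
    hand side is at most [4 * (maxdeg G + 1) * d]. *)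

Set Implicit Arguments.
Unset Strict Implicit.
Unset Printing Implicit Defensive.

Import Order.TTheory GRing.Theory Num.Theory.

(** * Cuts in connected graphs *)

Lemma connected_cut (H : mgraph) (S : {set vert H}) x y :
    connected H -> x \in S -> y \notin S ->
  exists e : edge H, ((ends e).1 \in S) != ((ends e).2 \in S).
Proof.
move=> cH + yS; have /connectP[p] := cH x y.
elim: p x => [|z p IHp] x /=; first by move=> _ <-; rewrite (negbTE yS).
case/andP=> /set0Pn[e exz] zp yp xS.
have [zS|zS] := boolP (z \in S); first exact: IHp zp yp zS.
exists e; move: exz; rewrite inE => /orP[]/eqP-> /=;
  by rewrite xS (negbTE zS).
Qed.

Lemma nonloop_edge (H : mgraph) (x : vert H) :
    connected H -> 1 < #|vert H| ->
  exists e : edge H, ((ends e).1 == x) != ((ends e).2 == x).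
Proof.
move=> cH; rewrite -cardsT (cardsD1 x) inE ltnS => /card_gt0P[y].
rewrite !inE andbT => yx.
have [e] := @connected_cut H [set x] x y cH (set11 x) ltac:(by rewrite inE).
by rewrite !inE; exists e.
Qed.

(** * Centroids of trees *)

(** Trees are grown one leaf at a time, so that statements about them can be
    proved by induction without changing the ambient graph. *)
Inductive subtree (T : mgraph) : {set vert T} -> {set edge T} -> Prop :=
| subtree1 v : subtree [set v] set0
| subtreeU S F e u v : subtree S F -> u \in S -> v \notin S ->
    e \in edges_between u v -> subtree (v |: S) (e |: F).

Lemma subtree_ends (T : mgraph) (S : {set vert T}) F : subtree S F ->
  forall e, e \in F -> ((ends e).1 \in S) && ((ends e).2 \in S).
Proof.
elim=> [v e|{}S {}F e u v _ IH uS vS euv e']; first by rewrite in_set0.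
case/setU1P => [->|/IH /andP[e1 e2]]; last by rewrite !inE e1 e2 !orbT.
by move: euv; rewrite !inE => /orP[]/eqP->; rewrite /= eqxx uS orbT.
Qed.

(** As long as the subtree misses a vertex, connectedness supplies an edge that
    leaves it. *)
Lemma subtree_of_card (T : mgraph) n : connected T -> n < #|vert T| ->
  exists S F, [/\ @subtree T S F, #|S| = n.+1 & #|F| = n].
Proof.
move=> cT; elim: n => [/card_gt0P[v _]|n IHn nT].
  by exists [set v], set0; rewrite cards1 cards0; split=> //; apply: subtree1.
have [S [F [SF cS cF]]] := IHn (ltnW nT).
have [x xS] : exists x, x \in S by apply/card_gt0P; rewrite cS.
have [y yS] : exists y, y \in ~: S.
  by apply/card_gt0P; rewrite cardsCs setCK cS subn_gt0.
rewrite inE in yS; have [e eS] := connected_cut cT xS yS.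
have eF : e \notin F.
  by apply: contra eS => /(subtree_ends SF)/andP[-> ->].
have [u [v [uS vS euv]]] :
    exists u v, [/\ u \in S, v \notin S & e \in edges_between u v].
  have e12 : e \in edges_between (ends e).1 (ends e).2.
    by rewrite inE -surjective_pairing eqxx.
  case: (boolP ((ends e).1 \in S)) eS => e1 e2.
    by exists (ends e).1, (ends e).2; split=> //; case: (_ \in S) e2.
  exists (ends e).2, (ends e).1; split=> //; first by case: (_ \in S) e2.
  by rewrite inE orbC; rewrite inE in e12.
exists (v |: S), (e |: F); split; first exact: subtreeU SF uS vS euv.
  by rewrite cardsU1 vS cS.
by rewrite cardsU1 eF cF.
Qed.

(** A spanning subtree has one edge fewer than vertices, which in a tree leaves
    no further edge. *)
Lemma tree_subtree (T : mgraph) : is_tree T -> @subtree T setT setT.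
Proof.
case=> cT EV; have [|S [F [SF cS cF]]] := @subtree_of_card T #|edge T| cT.
  by rewrite -EV addn1.
have -> : [set: vert T] = S.
  by apply/esym/eqP; rewrite eqEcard subsetT cardsT -EV cS addn1 leqnn.
suff -> : [set: edge T] = F by [].
by apply/esym/eqP; rewrite eqEcard subsetT cardsT cF leqnn.
Qed.

(** The labelling [c] records the components of the subtree minus [t]. When a
    leaf [v] is attached at [u], either [v] carries more than half of the
    weight and is itself the centroid, or its weight is moved to [u] and a
    centroid for the new weights still works: [v] joins the component of [u],
    or forms a light component of its own if [u] is the centroid. Keeping the
    labels inside [S] makes [v] available as a fresh label in that case. *)
Lemma subtree_centroid (T : mgraph) (S : {set vert T}) F :
    subtree S F -> forall mu : vert T -> nat,
  exists t (c : vert T -> vert T),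
    [/\ t \in S, forall x, x \in S -> c x \in S,
        forall e, e \in F -> (ends e).1 != t -> (ends e).2 != t ->
          c (ends e).1 = c (ends e).2 &
        forall k, 2 * (\sum_(x in S | (x != t) && (c x == k)) mu x)
                  <= \sum_(x in S) mu x].
Proof.
elim=> [v mu|{}S {}F e u v SF IH uS vS euv mu].
  exists v, (fun=> v); split=> [|x _|e|k]; rewrite ?set11 ?inE //.
  rewrite big1 ?muln0 // => x /andP[/set1P->].
  by rewrite eqxx.
have [v_heavy|v_light] := ltnP (\sum_(x in v |: S) mu x) (2 * mu v).
  exists v, (fun=> u); split=> [|x _|//|k]; rewrite ?setU11 ?inE ?uS ?orbT //.
  suff : \sum_(x in v |: S | (x != v) && (u == k)) mu x <= \sum_(x in S) mu x.
    by move: v_heavy; rewrite big_setU1 //=; lia.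
  rewrite big_mkcondr big_setU1 //= eqxx add0n leq_sum // => x _.
  by case: ifP.
pose mu' x := mu x + (x == u) * mu v.
have sum_mu' : \sum_(x in S) mu' x = \sum_(x in v |: S) mu x.
  rewrite big_setU1 //= big_split /= addnC; congr (_ + _).
  rewrite (bigD1 u) //= eqxx mul1n big1 ?addn0 // => x /andP[_ /negbTE->].
  by rewrite mul0n.
have [t [c [tS cS cF c_half]]] := IH mu'.
have tv : v != t by apply: contraNneq vS => ->.
pose c' x := if x == v then (if t == u then v else c u) else c x.
have c'S x : x \in S -> c' x = c x.
  by rewrite /c'; case: eqP => // ->; rewrite (negbTE vS).
have c'v : c' v = if t == u then v else c u by rewrite /c' eqxx.
exists t, c'; split=> [|x|e'|k].
- by rewrite !inE tS orbT.
- case/setU1P => [->|xS]; last by rewrite c'S // !inE cS ?orbT.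
  by rewrite c'v !inE; case: (t == u); rewrite ?eqxx ?cS // ?orbT.
- case/setU1P => [->|e'F]; last first.
    by have /andP[e1 e2] := subtree_ends SF e'F; rewrite !c'S //; apply: cF.
  move: euv; rewrite inE => /orP[]/eqP-> /=; rewrite c'v (c'S _ uS).
    by rewrite eq_sym => /negbTE->.
  by rewrite (eq_sym u) => _ /negbTE->.
rewrite big_mkcondr big_setU1 //= tv c'v /=.
rewrite (eq_bigr (fun x => if (x != t) && (c x == k) then mu x else 0));
  last by move=> x xS; rewrite c'S.
have [tu|tu] := eqVneq t u; last first.
  rewrite -sum_mu'; apply: leq_trans (c_half k).
  rewrite leq_pmul2l // big_mkcondr /=.
  rewrite [X in _ <= X](bigD1 u) //= [X in _ + X <= _](bigD1 u) //=.
  rewrite (eq_sym u) tu /= /mu' eqxx mul1n addnA.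
  apply: leq_add; first by case: ifP; lia.
  by apply: leq_sum => x _; case: ifP => // _; apply: leq_addr.
have [<-|kv] := eqVneq v k.
  rewrite big1 ?addn0 // => x xS; case: ifP => // /andP[_ /eqP cxv].
  by move: vS; rewrite -cxv cS.
rewrite add0n -sum_mu'; apply: leq_trans (c_half k).
rewrite leq_pmul2l // [X in _ <= X]big_mkcondr /=.
by apply: leq_sum => x _; case: ifP => // _; apply: leq_addr.
Qed.

Lemma tree_centroid (T : mgraph) (mu : vert T -> nat) : is_tree T ->
  exists t (c : vert T -> vert T),
    (forall e, (ends e).1 != t -> (ends e).2 != t ->
          c (ends e).1 = c (ends e).2) /\
    forall k, 2 * (\sum_(x | (x != t) && (c x == k)) mu x) <= \sum_x mu x.
Proof.
move=> /tree_subtree/subtree_centroid/(_ mu)[t [c [_ _ cE c_half]]].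
exists t, c; split=> [e|k]; first exact: cE.
have := c_half k; rewrite (eq_bigl (fun x => (x != t) && (c x == k))).
  by rewrite [X in _ <= X](eq_bigl predT) // => x; rewrite inE.
by move=> x; rewrite inE.
Qed.

(** * Tracing edges through a refinement *)

(** In a refinement [H], an edge of [G] becomes a path. The maps [vown] and
    [eown] send the interior vertices and the edges of these paths to the edge
    of [G] they come from, and [None] marks all the rest. That the edges owned
    by [e] contain a path between the ends of [e] is expressed dually: every
    2-colouring that separates the ends changes colour along an owned edge.
    In this form the property passes to subdivisions without any handling of
    paths. *)
Definition path_model (G H : mgraph) (iota : vert G -> vert H)
    (vown : vert H -> option (edge G)) (eown : edge H -> option (edge G)) :=
  [/\ injective iota,
      forall h e z, eown h = Some e -> h \in incident z ->
        [\/ vown z = Some e, z = iota (ends e).1 | z = iota (ends e).2] &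
      forall (c : vert H -> bool) e,
        c (iota (ends e).1) != c (iota (ends e).2) ->
        exists2 h, eown h = Some e & c (ends h).1 != c (ends h).2].

Lemma refinement_paths (G H : mgraph) : refinement G H ->
  exists iota vown eown, @path_model G H iota vown eown.
Proof.
elim=> [|{}H h0 _ [i [vo [eo [i_inj own path]]]]
        |{}H v0 _ [i [vo [eo [i_inj own path]]]]
        |{}H K _ [i [vo [eo [i_inj own path]]]] [f [g [fbij gbij fg]]]].
- exists id, (fun=> None), Some; split=> // [h e z [->]|c e ce].
    by rewrite inE => /orP[]/eqP<-; [apply: Or32|apply: Or33].
  by exists e.
- exists (Some \o i), (fun o => if o is Some z then vo z else eo h0),
    (fun o => if o is Some h then eo h else eo h0).
  split=> [x y /Some_inj/i_inj //|[h|] e [z|] ho|c e ce] /=.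
  + rewrite inE /= (inj_eq Some_inj) => hz.
    have [|/=|->|->] := own h e z ho.
    * rewrite inE; case/orP: hz => [->//|].
      by case: (h == h0) => //; rewrite (inj_eq Some_inj) => ->; rewrite orbT.
    * by move=> ?; apply: Or31.
    * exact: Or32.
    * exact: Or33.
  + rewrite inE /=; have [<- _|] := eqVneq h h0; first exact: Or31.
    by case: eqP.
  + rewrite inE /= (inj_eq Some_inj) => hz.
    have [|/=|->|->] := own h0 e z ho; first by rewrite inE hz orbT.
    * by move=> ?; apply: Or31.
    * exact: Or32.
    * exact: Or33.
  + by move=> _; apply: Or31.
  have [h ho ch] := path (c \o Some) e ce; rewrite /= in ch.
  have [hh0|hh0] := eqVneq h h0; last first.
    by exists (Some h); rewrite //= (negbTE hh0).
  have [cN|cN] := eqVneq (c (Some (ends h).1)) (c None).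
    exists None; rewrite /= -?hh0 //.
    by rewrite -cN.
  by exists (Some h); rewrite //= hh0 eqxx -hh0.
- exists (Some \o i), (fun o => if o is Some z then vo z else None),
    (fun o => if o is Some h then eo h else None).
  split=> [x y /Some_inj/i_inj //|[h|] e [z|] ho|c e ce] //=.
  + rewrite inE /= !(inj_eq Some_inj) => hz.
    have [|/=|->|->] := own h e z ho; first by rewrite inE hz.
    * by move=> ?; apply: Or31.
    * exact: Or32.
    * exact: Or33.
  + by rewrite inE.
  have [h ho ch] := path (c \o Some) e ce.
  by exists (Some h).
case: fbij => f' fK f'K; case: gbij => g' gK g'K.
have gE h : (ends (g h) == (f (ends h).1, f (ends h).2))
         || (ends (g h) == (f (ends h).2, f (ends h).1)).
  have := fg h (ends h).1 (ends h).2; rewrite !inE -surjective_pairing eqxx.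
  by apply.
exists (f \o i), (vo \o f'), (eo \o g'); split=> [|h e z ho hz|c e ce] /=.
- exact: inj_comp (can_inj fK) i_inj.
- have [|->|<-|<-] := own (g' h) e (f' z) ho.
  + have := gE (g' h); rewrite g'K !inE => /orP[]/eqP hE; move: hz;
      rewrite inE hE /= => /orP[]/eqP<-; rewrite fK eqxx ?orbT //.
  + exact: Or31.
  + by rewrite f'K; apply: Or32.
  + by rewrite f'K; apply: Or33.
have [h ho ch] := path (c \o f) e ce.
exists (g h); rewrite /= ?gK //.
by case/orP: (gE h) => /eqP-> //=; rewrite eq_sym.
Qed.

(** * Degrees, volumes and cuts *)

Lemma vdegE (G : mgraph) (v : vert G) :
  vdeg v = \sum_e (((ends e).1 == v) + ((ends e).2 == v)).
Proof.
rewrite /vdeg -!sum1_card (big_mkcond (mem (incident v))).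
rewrite (big_mkcond (mem (edges_between v v))) -big_split.
apply: eq_bigr => e _; rewrite !inE orbb -pair_eqE /=.
by case: eqP; case: eqP.
Qed.

Definition volume (G : mgraph) (A : {set vert G}) : nat :=
  \sum_(v in A) vdeg v.

Definition cut (G : mgraph) (A : {set vert G}) : {set edge G} :=
  [set e | ((ends e).1 \in A) != ((ends e).2 \in A)].

(** * The cuts pulled back from the centroid *)

(** The degree is the sum of the multiplicities over the fibre, and a vertex
    that meets an edge [h] has multiplicity at least the index of [h]. *)
Lemma card_fibre_le_degree (G H : mgraph) (phi : harmonic_morphism G H) t :
    connected H ->
  #|[set z | (mor_v phi z == t) && (incident z != set0)]| <= degree phi.
Proof.
move=> cH; rewrite (degreeE phi t cH) /degree_at -sum1_card.
rewrite [X in _ <= X]big_mkcond [X in X <= _]big_mkcond /=.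
apply: leq_sum => z _; rewrite inE.
case: ifP => //= /andP[-> /set0Pn[h hz]].
have phi_h : mor_e phi h \in incident (mor_v phi z).
  have := @mor_ends _ _ phi h (ends h).1 (ends h).2.
  rewrite inE -surjective_pairing eqxx => /(_ isT).
  by move: hz; rewrite !inE => /orP[]/eqP<- /orP[]/eqP->; rewrite /= eqxx ?orbT.
rewrite ((hmorP phi z).1 _ phi_h) (bigD1 h) ?hz ?eqxx //=.
by rewrite addn_gt0 edge_index_gt0.
Qed.

Lemma sum_eqb (T : finType) (x : T) : \sum_k (x == k) = 1.
Proof.
rewrite (bigD1 x) //= eqxx big1 ?addn0 // => k /negbTE.
by rewrite eq_sym => ->.
Qed.

(** The sets [A k] are the parts of [G] above the components of the tree minus
    its centroid [t]. The volume they miss lies above [t], and the edges of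
    their cuts are charged to vertices of [G'] above [t]. *)
Lemma centroid_cuts (G G' T : mgraph) (phi : harmonic_morphism G' T) :
    connected G -> 1 < #|vert G| -> refinement G G' -> is_tree T ->
  exists A : vert T -> {set vert G},
    [/\ forall k, 2 * volume (A k) <= vol G,
        vol G <= \sum_k volume (A k) + maxdeg G * degree phi &
        \sum_k #|cut (A k)| <= (maxdeg G + 2) * degree phi].
Proof.
move=> cG G2 /refinement_paths[i [vo [eo [i_inj own path]]]] treeT.
pose mu t := \sum_(v | mor_v phi (i v) == t) vdeg v.
have [t [c [cE c_half]]] := tree_centroid mu treeT.
pose over v := mor_v phi (i v) == t.
pose cls v := c (mor_v phi (i v)).
pose A k := [set v | ~~ over v && (cls v == k)].
pose Z := [set z | (mor_v phi z == t) && (incident z != set0)].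
have Zd : #|Z| <= degree phi := card_fibre_le_degree phi t treeT.1.
have volA k : volume (A k) = \sum_(x | (x != t) && (c x == k)) mu x.
  rewrite /volume /mu (exchange_big_dep predT) //= big_mkcond /=.
  apply: eq_bigr => v _; rewrite inE.
  rewrite (big_mkcond (fun x => _ && (_ == x))) /=.
  rewrite (bigD1 (mor_v phi (i v))) //= eqxx andbT big1 ?addn0 // => x.
  by rewrite eq_sym => /negbTE->; rewrite andbF.
have volmu : \sum_x mu x = vol G.
  by rewrite /vol /mu (partition_big (fun v => mor_v phi (i v)) predT).
have over_card : #|[set v | over v]| <= #|Z|.
  rewrite -(card_imset _ i_inj) subset_leq_card //.
  apply/subsetP => z /imsetP[v]; rewrite !inE => ov ->.
  rewrite -/(over v) ov; apply/set0Pn.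
  have [e ev] := nonloop_edge v cG G2.
  have [|h _ hv] := path (fun z => z == i v) e.
    by rewrite !(inj_eq i_inj).
  exists h; apply: contraR hv.
  by rewrite inE negb_or => /andP[/negbTE-> /negbTE->].
have over_deg : \sum_(v | over v) vdeg v <= maxdeg G * degree phi.
  apply: leq_trans (leq_mul (leqnn _) (leq_trans over_card Zd)).
  rewrite mulnC -sum_nat_const; under [X in _ <= X]eq_bigl do rewrite inE.
  by apply: leq_sum => v _; apply: leq_bigmax.
exists A; split=> [k||].
- by rewrite volA -volmu.
- suff -> : vol G = \sum_k volume (A k) + \sum_(v | over v) vdeg v.
    by rewrite leq_add2l.
  rewrite /vol (bigID over) /= addnC; congr (_ + _).
  rewrite /volume (exchange_big_dep (fun v => ~~ over v)) /= => [|k v _].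
    apply: eq_bigr => v nov.
    by rewrite (big_pred1 (cls v)) // => k; rewrite inE nov eq_sym.
  by rewrite inE => /andP[].
(* An edge is charged to its ends above [t] or, if there are none, twice to
   one of its subdivision vertices above [t]. *)
have cut_edge e : \sum_k (e \in cut (A k))
    <= over (ends e).1 + over (ends e).2
       + 2 * \sum_(z in Z) (vo z == Some e).
  have le2 : \sum_k (e \in cut (A k))
      <= ~~ over (ends e).1 + ~~ over (ends e).2.
    apply: (@leq_trans (\sum_k (~~ over (ends e).1 * (cls (ends e).1 == k)
                + ~~ over (ends e).2 * (cls (ends e).2 == k)))).
      apply: leq_sum => k _; rewrite !inE.
      by case: (over _); case: (over _); case: (_ == k); case: (_ == k).
    by rewrite big_split -!big_distrr /= !sum_eqb !muln1.
  have [e_over|] := boolP (over (ends e).1 || over (ends e).2).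
    apply: leq_trans le2 _; apply: leq_trans (leq_addr _ _).
    by case: (over _) e_over; case: (over _).
  rewrite negb_or => /andP[o1 o2].
  have [cls_eq|cls_neq] := eqVneq (cls (ends e).1) (cls (ends e).2).
    by rewrite big1 // => k _; rewrite !inE o1 o2 cls_eq eqxx.
  (* The path refining [e] has to leave the part of [G'] above the component
     of its first end, and it can only do so through the fibre of [t]. *)
  pose W z := (mor_v phi z != t) && (c (mor_v phi z) == cls (ends e).1).
  have [|h ho hW] := path W e.
    rewrite /W -/(over _) -/(over _) o1 o2 -/(cls _) -/(cls _) eqxx.
    by rewrite (eq_sym (cls _)) (negbTE cls_neq).
  have [z hz zt] : exists2 z, h \in incident z & mor_v phi z == t.
    have [h1|h1] := boolP (mor_v phi (ends h).1 == t).
      by exists (ends h).1; rewrite // inE eqxx.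
    have [h2|h2] := boolP (mor_v phi (ends h).2 == t).
      by exists (ends h).2; rewrite // inE eqxx orbT.
    have c12 : c (mor_v phi (ends h).1) = c (mor_v phi (ends h).2).
      have := @mor_ends _ _ phi h (ends h).1 (ends h).2.
      rewrite !inE -surjective_pairing eqxx => /(_ isT)/orP[]/eqP hE.
        by have := cE (mor_e phi h); rewrite hE; apply.
      by have := cE (mor_e phi h); rewrite hE => cE'; apply/esym/cE'.
    by move: hW; rewrite /W h1 h2 c12 eqxx.
  have voz : vo z = Some e.
    case: (own h e z ho hz) => // zi; first by move: o1; rewrite /over -zi zt.
    by move: o2; rewrite /over -zi zt.
  have zZ : z \in Z by rewrite inE zt; apply/set0Pn; exists h.
  apply: leq_trans le2 _; rewrite (bigD1 z zZ) /= voz eqxx o1 o2.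
  by rewrite mulnDr muln1 addnCA leq_addr.
have -> : \sum_k #|cut (A k)| = \sum_e \sum_k (e \in cut (A k)).
  rewrite exchange_big; apply: eq_bigr => k _ /=.
  by rewrite -sum1_card big_mkcond; apply: eq_bigr => e _; case: (_ \in _).
apply: leq_trans (leq_sum _ (fun e _ => cut_edge e)) _.
rewrite big_split /= -big_distrr /= mulnDl; apply: leq_add.
  apply: leq_trans over_deg; rewrite (eq_bigr _ (fun v _ => vdegE v)).
  rewrite exchange_big /=; apply: leq_sum => e _.
  rewrite big_split /= !(big_mkcond over) /=; apply: leq_add.
    by rewrite (bigD1 (ends e).1) //= eqxx; case: (over _).
  by rewrite (bigD1 (ends e).2) //= eqxx; case: (over _).
rewrite leq_mul2l /= exchange_big; apply: leq_trans Zd.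
rewrite -sum1_card; apply: leq_sum => z _ /=.
case: (vo z) => [e|]; last by rewrite big1.
by rewrite -[X in _ <= X](sum_eqb e).
Qed.

(** * Spectral gap of real symmetric matrices *)

Local Open Scope ring_scope.
Local Open Scope sesquilinear_scope.

(** In an orthonormal eigenbasis the two forms are weighted sums of squared
    coordinates. The coordinates of [g] on the kernel vanish because the kernel
    lies in the line of [w], and all other eigenvalues are at least [lam]. The
    basis is found over the complex numbers; as [A] becomes hermitian there,
    its complex eigenvalues are real and so are eigenvalues over [R]. *)
Lemma symmetric_gap (R : rcfType) n (A : 'M[R]_n) (w g : 'rV[R]_n) lam :
    A^T = A -> (kermx A <= w)%MS -> g *m w^T = 0 ->
    (forall a, eigenvalue A a -> a != 0 -> lam <= a) ->
  lam * (g *m g^T) 0 0 <= (g *m A *m g^T) 0 0.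
Proof.
move=> symA kerA gw lamP.
pose toC := real_complex R; pose B := map_mx toC A.
have realC m p (M : 'M[R]_(m, p)) : (map_mx toC M)^t* = (map_mx toC M)^T.
  by apply/matrixP => i j; rewrite !mxE conj_Creal // complex_real.
have Bherm : B \is hermsymmx.
  apply: realsym_hermsym; last first.
    by apply/mxOverP => i j; rewrite mxE complex_real.
  apply/is_hermitianmxP; rewrite expr0 scale1r map_mx_id //.
  by apply/matrixP => i j; rewrite !mxE -[in LHS]symA mxE.
have := hermitian_normalmx Bherm => /orthomx_spectralP.
have := hermitian_spectral_diag_real Bherm.
have := spectral_unitarymx B.
set P := spectralmx B; set sp := spectral_diag B => Pu spR.
rewrite invmx_unitary // => defB.
have eigP i : row i P *m B = sp 0 i *: row i P.
  rewrite defB !mulmxA -row_mul (unitarymxP Pu) row1 -rowE row_diag_mx.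
  by rewrite -scalemxAl -rowE.
(* The coordinates of [g] in the eigenbasis formed by the rows of [P]. *)
pose u : 'rV_n := map_mx toC g *m P^t*.
have gwC : map_mx toC g *m (map_mx toC w)^T = 0.
  by rewrite map_trmx -map_mxM gw map_mx0.
have uP i : toC lam * (u 0 i * (u 0 i)^*) <= sp 0 i * (u 0 i * (u 0 i)^*).
  have [sp0|spn0] := eqVneq (sp 0 i) 0.
    suff -> : u 0 i = 0 by rewrite !mul0r !mulr0.
    have /submxP[c rowc] : (row i P <= map_mx toC w)%MS.
      have := kerA; rewrite -(map_submx toC); apply: submx_trans.
      by rewrite map_kermx; apply/sub_kermxP; rewrite eigP sp0 scale0r.
    have -> : u 0 i = (map_mx toC g *m (row i P)^t*) 0 0.
      by rewrite !mxE; apply: eq_bigr => j _; rewrite !mxE.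
    by rewrite rowc trmx_mul map_mxM /= realC mulmxA gwC mul0mx mxE.
  have /complex_realP[a spa] : sp 0 i \is Num.real by apply: (mxOverP spR).
  have rown0 : row i P != 0.
    apply/eqP => row0; have := unitarymx_unit Pu.
    by rewrite -row_free_unit => /row_freeP[Q]
      /(congr1 (row i)); rewrite row_mul row0 mul0mx => /rowP/(_ i);
      rewrite !mxE eqxx => /eqP; rewrite eq_sym oner_eq0.
  have lea : toC lam <= sp 0 i.
    rewrite spa lecR lamP; first by [].
      rewrite -(eigenvalue_map toC) -/B; apply/eigenvalueP.
      by exists (row i P); rewrite // eigP spa.
    by apply: contraNneq spn0 => a0; rewrite spa a0.
  by rewrite ler_wpM2r // mul_conjC_ge0.
have uu : toC ((g *m g^T) 0 0) = \sum_i u 0 i * (u 0 i)^*.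
  have -> : toC ((g *m g^T) 0 0) = (u *m u^t*) 0 0.
    rewrite /u trmx_mul map_mxM /= trmxCK realC mulmxA mulmxKtV //.
    by rewrite map_trmx -map_mxM [RHS]mxE.
  by rewrite mxE; apply: eq_bigr => j _; rewrite !mxE.
have uAu : toC ((g *m A *m g^T) 0 0) = \sum_i sp 0 i * (u 0 i * (u 0 i)^*).
  have -> : toC ((g *m A *m g^T) 0 0) = (u *m diag_mx sp *m u^t*) 0 0.
    rewrite /u trmx_mul map_mxM /= trmxCK realC map_trmx !mulmxA.
    rewrite -(mulmxA _ _ (diag_mx sp)) -(mulmxA _ _ P) -defB.
    by rewrite /B -!map_mxM [RHS]mxE.
  rewrite mxE; apply: eq_bigr => j _; rewrite mul_mx_diag !mxE.
  by rewrite mulrCA mulrA.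
have -> : (lam * (g *m g^T) 0 0 <= (g *m A *m g^T) 0 0) =
    (toC lam * toC ((g *m g^T) 0 0) <= toC ((g *m A *m g^T) 0 0)).
  by rewrite -rmorphM lecR.
rewrite uu uAu mulr_sumr.
exact: ler_sum.
Qed.

(** * The Laplacian and its Dirichlet form *)

Section Laplacian.
Variable (R : realType) (G : mgraph).
Implicit Types (f : vert G -> R) (x v : vert G) (e : edge G).

Lemma sum_delta (T : finType) (F : T -> R) (x : T) :
  \sum_v (x == v)%:R * F v = F x.
Proof.
rewrite (bigD1 x) //= eqxx mul1r big1 ?addr0 // => v /negbTE.
by rewrite eq_sym => ->; rewrite mul0r.
Qed.

Lemma sum_vdeg f :
  \sum_v (vdeg v)%:R * f v = \sum_e (f (ends e).1 + f (ends e).2).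
Proof.
under eq_bigr => v _ do rewrite vdegE natr_sum mulr_suml.
rewrite exchange_big; apply: eq_bigr => e _ /=.
under eq_bigr => v _ do rewrite natrD mulrDl.
by rewrite big_split !sum_delta.
Qed.

Lemma sum_enum_val (F : vert G -> R) :
  \sum_(i < #|vert G|) F (enum_val i) = \sum_v F v.
Proof.
rewrite [RHS](reindex (@enum_val _ (vert G))) //.
exact/onW_bij/enum_val_bij.
Qed.

Definition fun_row f : 'rV[R]_#|vert G| := \row_i f (enum_val i).

Lemma fun_row_dot f1 f2 :
  (fun_row f1 *m (fun_row f2)^T) 0 0 = \sum_v f1 v * f2 v.
Proof. by rewrite mxE -sum_enum_val; apply: eq_bigr => i _; rewrite !mxE. Qed.

Definition energy f : R := \sum_e (f (ends e).1 - f (ends e).2) ^+ 2.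

Lemma adj_mxE i j : adj_mx R G i j =
  \sum_e ((ends e == (enum_val i, enum_val j))%:R
        + (ends e == (enum_val j, enum_val i))%:R).
Proof.
rewrite mxE -(inj_eq (@enum_val_inj _ (vert G))).
set x := enum_val i; set y := enum_val j.
rewrite /edges_between -!sum1dep_card !natr_sum.
have [<-|nxy] := eqVneq x y.
  rewrite natrM natr_sum mulr_sumr big_mkcond; apply: eq_bigr => e _.
  by case: (ends e == _); rewrite ?mulr1 -?natrD ?addr0.
rewrite big_mkcond; apply: eq_bigr => e _.
case: eqVneq => [->|_]; last by case: eqVneq; rewrite /= ?add0r.
by rewrite -pair_eqE /= (negbTE nxy) addr0.
Qed.

(** Both the degrees and the adjacency numbers are sums over edges, so the form
    splits into the contributions [(f x - f y) ^+ 2] of the edges. *)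
Lemma laplacianE f :
  (fun_row f *m laplacian R G *m (fun_row f)^T) 0 0 = energy f.
Proof.
rewrite /laplacian mulmxBr mulmxBl mxE [X in _ + X]mxE.
have -> : (fun_row f *m deg_mx R G *m (fun_row f)^T) 0 0
    = \sum_e (f (ends e).1 ^+ 2 + f (ends e).2 ^+ 2).
  rewrite -(sum_vdeg (fun v => f v ^+ 2)) mxE -sum_enum_val.
  by apply: eq_bigr => i _; rewrite mul_mx_diag !mxE mulrAC mulrC expr2.
have -> : (fun_row f *m adj_mx R G *m (fun_row f)^T) 0 0
    = \sum_e (f (ends e).1 * f (ends e).2 *+ 2).
  have -> : (fun_row f *m adj_mx R G *m (fun_row f)^T) 0 0
      = \sum_y \sum_x \sum_e ((ends e == (x, y))%:R
                + (ends e == (y, x))%:R) * (f x * f y).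
    rewrite mxE -sum_enum_val; apply: eq_bigr => j _.
    rewrite mxE mulr_suml -sum_enum_val; apply: eq_bigr => i _.
    by rewrite adj_mxE 3!mxE mulrAC mulrC mulr_suml.
  under eq_bigr => y _ do rewrite exchange_big.
  rewrite exchange_big; apply: eq_bigr => e _ /=.
  have splitE x y (c : R) :
      ((ends e == (x, y))%:R + (ends e == (y, x))%:R) * c =
      ((ends e).1 == x)%:R * (((ends e).2 == y)%:R * c)
      + ((ends e).2 == x)%:R * (((ends e).1 == y)%:R * c).
    rewrite -!pair_eqE /= -!mulnb !natrM mulrDl -!mulrA; congr (_ + _).
    exact: mulrCA.
  under eq_bigr => y _.
    under eq_bigr => x _ do rewrite splitE.
    rewrite big_split /= !sum_delta.
    over.
  by rewrite big_split /= !sum_delta mulr2n [X in _ + X]mulrC.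
rewrite -sumrB; apply: eq_bigr => e _.
by rewrite sqrrB addrAC.
Qed.

Lemma energy_ge0 f : 0 <= energy f.
Proof. by apply: sumr_ge0 => e _; apply: sqr_ge0. Qed.

Lemma energy_eq0 f : connected G -> energy f = 0 -> forall x y, f x = f y.
Proof.
move=> cG /eqP; rewrite psumr_eq0 => [/allP f0|e _]; last exact: sqr_ge0.
have f_ends e : f (ends e).1 = f (ends e).2.
  have := f0 e (mem_index_enum e).
  by rewrite /= sqrf_eq0 subr_eq0 => /eqP.
move=> x y; have /connectP[p] := cG x y.
elim: p x => [|z p IHp] x /=; first by move=> _ ->.
case/andP=> /set0Pn[e]; rewrite !inE => exz zp yp; rewrite -(IHp z zp yp).
by case/orP: exz => /eqP e_xz; have := f_ends e; rewrite e_xz.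
Qed.

Lemma laplacian_sym : (laplacian R G)^T = laplacian R G.
Proof.
rewrite /laplacian linearB /= tr_diag_mx; congr (_ - _).
apply/matrixP => i j; rewrite mxE !adj_mxE.
by apply: eq_bigr => e _; rewrite addrC.
Qed.

Lemma normalized_laplacian_sym :
  (normalized_laplacian R G)^T = normalized_laplacian R G.
Proof.
by rewrite /normalized_laplacian !trmx_mul laplacian_sym tr_diag_mx mulmxA.
Qed.

(** * The first normalized eigenvalue *)

Definition sqrt_deg v : R := Num.sqrt (vdeg v)%:R.

Lemma sqrt_deg_sqr v : sqrt_deg v * sqrt_deg v = (vdeg v)%:R.
Proof. by rewrite -expr2 sqr_sqrtr ?ler0n. Qed.

Hypothesis deg_gt0 : forall v, (0 < vdeg v)%N.

Lemma sqrt_deg_neq0 v : sqrt_deg v != 0.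
Proof. by rewrite gt_eqF // sqrtr_gt0 ltr0n. Qed.

(** Scaling by the square roots of the degrees turns the normalized form into
    the Dirichlet form. *)
Lemma normalized_laplacianE f :
  let g := fun_row (fun v => sqrt_deg v * f v) in
  (g *m normalized_laplacian R G *m g^T) 0 0 = energy f.
Proof.
move=> g; have gf : g *m deg_invsqrt_mx R G = fun_row f.
  apply/rowP => i; rewrite mul_mx_diag !mxE mulrAC divff ?mul1r //.
  exact: sqrt_deg_neq0.
rewrite -laplacianE -gf trmx_mul /normalized_laplacian !mulmxA.
by rewrite [(deg_invsqrt_mx R G)^T]tr_diag_mx.
Qed.

Lemma fun_rowP (g : 'rV[R]_#|vert G|) :
  exists f, g = fun_row (fun v => sqrt_deg v * f v).
Proof.
exists (fun v => g 0 (enum_rank v) / sqrt_deg v).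
apply/rowP => i; rewrite mxE enum_valK mulrCA divff ?mulr1 //.
exact: sqrt_deg_neq0.
Qed.

Lemma first_eigenvalue_ge0 lam :
  first_eigenvalue (normalized_laplacian R G) lam -> 0 <= lam.
Proof.
case=> /eigenvalueP[g gE g0] _ _; have [f gf] := fun_rowP g.
have := energy_ge0 f; rewrite -normalized_laplacianE -gf gE -scalemxAl mxE.
have gg : 0 < (g *m g^T) 0 0.
  rewrite gf fun_row_dot lt_def sumr_ge0 ?andbT => [|v _]; last first.
    by rewrite -expr2 sqr_ge0.
  apply: contraNneq g0 => /eqP.
  rewrite psumr_eq0 => [/allP f0|v _]; last by rewrite -expr2 sqr_ge0.
  apply/eqP/rowP => i; rewrite gf !mxE; apply/eqP.
  by have := f0 _ (mem_index_enum (enum_val i)); rewrite /= -expr2 sqrf_eq0.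
by rewrite pmulr_lge0.
Qed.

(** Functions of zero energy are constant on a connected graph, so the kernel
    of the normalized Laplacian is the line of [sqrt_deg], and the condition on
    the mean of [f] is orthogonality to that line. *)
Lemma poincare lam f : connected G ->
    first_eigenvalue (normalized_laplacian R G) lam ->
    \sum_v (vdeg v)%:R * f v = 0 ->
  lam * (\sum_v (vdeg v)%:R * f v ^+ 2) <= energy f.
Proof.
move=> cG [_ _ lam_min] f0.
set g := fun_row (fun v => sqrt_deg v * f v).
have -> : \sum_v (vdeg v)%:R * f v ^+ 2 = (g *m g^T) 0 0.
  rewrite fun_row_dot; apply: eq_bigr => v _.
  by rewrite -sqrt_deg_sqr expr2 mulrACA.
rewrite -normalized_laplacianE -/g.
apply: (@symmetric_gap _ _ _ (fun_row sqrt_deg)) => //.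
- exact: normalized_laplacian_sym.
- apply/rV_subP => h /sub_kermxP; have [k ->] := fun_rowP h => k0.
  have k_const : forall x y, k x = k y.
    by apply: energy_eq0 => //; rewrite -normalized_laplacianE k0 mul0mx mxE.
  apply/sub_rVP; case: (pickP (vert G)) => [v _|noV].
    exists (k v); apply/rowP => i.
    by rewrite !mxE mulrC (k_const _ v).
  by exists 0; apply/rowP => i; have := noV (enum_val i).
- apply/rowP => i; rewrite ord1 fun_row_dot mxE -[RHS]f0.
  by apply: eq_bigr => v _; rewrite mulrAC sqrt_deg_sqr.
Qed.

(** The Poincare inequality for the indicator function of [A] minus its mean
    [p]: the energy is the size of the cut, and the variance is
    [volume A * (1 - p)] with [p <= 1 / 2]. *)
Lemma cut_lower_bound lam (A : {set vert G}) : connected G ->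
    first_eigenvalue (normalized_laplacian R G) lam ->
    (2 * volume A <= vol G)%N ->
  lam * (volume A)%:R <= 2 * #|cut A|%:R.
Proof.
move=> cG lamP A_half.
pose p : R := (volume A)%:R / (vol G)%:R.
pose f v : R := (v \in A)%:R - p.
have [vol0|vol_gt0] := posnP (vol G).
  move: A_half; rewrite vol0 leqn0 muln_eq0 /= => /eqP->.
  by rewrite mulr0 mulr_ge0 ?ler0n.
have volE : \sum_(v : vert G) (vdeg v)%:R = (vol G)%:R :> R.
  by rewrite /vol natr_sum.
have volumeE : \sum_v (vdeg v)%:R * (v \in A)%:R = (volume A)%:R :> R.
  rewrite natr_sum [RHS]big_mkcond; apply: eq_bigr => v _.
  by case: (v \in A); rewrite ?mulr1 ?mulr0.
have volp : p * (vol G)%:R = (volume A)%:R.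
  by rewrite divfK // pnatr_eq0 -lt0n.
have f0 : \sum_v (vdeg v)%:R * f v = 0.
  under eq_bigr => v _ do rewrite mulrBr.
  by rewrite sumrB volumeE -mulr_suml volE mulrC volp subrr.
have fE : energy f = #|cut A|%:R.
  rewrite -sum1_card natr_sum [RHS]big_mkcond; apply: eq_bigr => e _.
  rewrite inE /f opprB addrA subrK.
  by case: (_ \in A); case: (_ \in A);
    rewrite ?subrr ?subr0 ?sub0r ?sqrrN ?expr1n ?expr0n.
have f2 : \sum_v (vdeg v)%:R * f v ^+ 2 = (volume A)%:R * (1 - p).
  transitivity (\sum_v ((vdeg v)%:R * (v \in A)%:R * (1 - p) 
      - p * ((vdeg v)%:R * f v))).
    apply: eq_bigr => v _; rewrite /f.
    by case: (v \in A) => /=; ring.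
  by rewrite sumrB -mulr_suml -mulr_sumr f0 mulr0 subr0 volumeE.
have p_half : p <= 1 / 2.
  by rewrite ler_pdivrMr ?ltr0n // mulrAC ler_pdivlMr // mul1r mulrC
    -natrM ler_nat.
have := poincare cG lamP f0; rewrite f2 fE => le_cut.
have := first_eigenvalue_ge0 lamP => lam0.
have := ler0n R (volume A) => A0.
have := mulr_ge0 lam0 A0.
nra.
Qed.
End Laplacian.

(** * The lower bound on the gonality *)

Theorem theorem7p7 (R : realType) (G : mgraph) (lam : R) (d : nat)
    (hconn : connected G) (hcard : (1 < #|vert G|)%N)
    (hlam : first_eigenvalue (normalized_laplacian R G) lam)
    (hd : is_sgon G d) :
  lam / ((maxdeg G)%:R * lam + 4 * ((maxdeg G)%:R + 1)) * (vol G)%:R <= d%:R.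
Proof.
case: hd => [[G' [T [phi [refG' _ treeT <-]]]] _].
have [A [A_half A_vol A_cut]] :=
  centroid_cuts phi hconn hcard refG' treeT.
have deg_gt0 (v : vert G) : (0 < vdeg v)%N.
  have [e ev] := nonloop_edge v hconn hcard.
  rewrite vdegE (bigD1 e) //=.
  by case: ((ends e).1 == v) ev; case: ((ends e).2 == v).
have lam0 := first_eigenvalue_ge0 deg_gt0 hlam.
have gap : lam * (\sum_k volume (A k))%:R <= 2 * (\sum_k #|cut (A k)|)%:R.
  rewrite !natr_sum !mulr_sumr; apply: ler_sum => k _.
  exact: cut_lower_bound.
move: gap A_vol A_cut.
set V := (\sum_k _)%N; set C := (\sum_k _)%N.
rewrite -!(ler_nat R) !natrD !natrM !natrD.
set D : R := (maxdeg G)%:R; set N : R := (degree phi)%:R.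
move: (ler0n R (maxdeg G)) (ler0n R (degree phi)); rewrite -/D -/N.
move: V%:R C%:R (vol G)%:R => {}V {}C U D0 N0 gap volU cutC.
have den0 : 0 < D * lam + 4 * (D + 1).
  by have := mulr_ge0 D0 lam0; lra.
rewrite mulrAC ler_pdivrMr //.
have := ler_wpM2l lam0 volU; have := mulr_ge0 D0 N0; nra.
Qed.
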